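(* Let $d\ge2$, let $X_1,\dots,X_d$ be Polish spaces, $E=X_1\times\dots\times X_d$, and let $c:E\to\mathbb{R}$ be a measurable cost function. Then every $c$-cyclically monotone set $\Gamma\subseteq E$ is $c$-splitting.
   Context: A set $\Gamma\subseteq E$ is $c$-cyclically monotone if it satisfies either of the following two equivalent conditions: (i) for any $n\ge1$, any points $(x_1^{(1)},\dots,x_d^{(1)}),\dots,(x_1^{(n)},\dots,x_d^{(n)})\in\Gamma$ and any permutations $\sigma_2,\dots,\sigma_d$ of $\{1,\dots,n\}$, $$\sum_{i=1}^n c\bigl(x_1^{(i)},\dots,x_d^{(i)}\bigr)\le\sum_{i=1}^n c\bigl(x_1^{(i)},x_2^{(\sigma_2(i))},\dots,x_d^{(\sigma_d(i))}\bigr);$$ (ii) for any finite measure $\alpha$ concentrated on finitely many points of $\Gamma$ and any measure $\alpha'$ on $E$ with the same marginals as $\alpha$, $\int c\,d\alpha\le\int c\,d\alpha'$. A set $G\subseteq E$ is $c$-splitting if there exist functions $\varphi_i:X_i\to[-\infty,\infty)$, $i=1,\dots,d$ (no regularity or measurability is required), such that $\varphi_1(x_1)+\dots+\varphi_d(x_d)\le c(x_1,\dots,x_d)$ for all $(x_1,\dots,x_d)\in E$, and $\varphi_1(x_1)+\dots+\varphi_d(x_d)=c(x_1,\dots,x_d)$ for all $(x_1,\dots,x_d)\in G$. A sum in which some term is $-\infty$ equals $-\infty$. *)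

(* Defs.v *)
From HB Require Import structures.
From mathcomp Require Import all_boot all_order all_algebra all_fingroup.
From mathcomp Require Import all_classical all_reals all_analysis.

Set Implicit Arguments.
Unset Strict Implicit.
Unset Printing Implicit Defensive.

Import Order.TTheory GRing.Theory Num.Theory.
Import numFieldNormedType.Exports.

Local Open Scope classical_set_scope.
Local Open Scope ring_scope.

Definition separable (T : topologicalType) : Prop :=
  exists2 D : set T, countable D & dense D.

(* Same axiom as in [completeType], which however also requires a base point. *)
Definition complete (M : uniformType) : Prop :=
  forall F : set_system M, ProperFilter F -> cauchy F -> exists l : M, F --> l.

(* The complete metric is not part of the data of a Polish space: it is only
   required that the topology can be induced by some complete metric. *)
Definition completely_metrizable (R : realType) (T : topologicalType) : Prop :=
  exists (M : metricType R) (f : T -> M) (g : M -> T),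
    [/\ cancel f g, cancel g f, continuous f, continuous g & complete M].

Definition polish_space (R : realType) (T : topologicalType) : Prop :=
  separable T /\ completely_metrizable R T.

(* Measurability with respect to the Borel sigma-algebras. The sigma-algebra
   <<s @open T >> is used directly, since [g_sigma_algebraType] is a
   [measurableType] only over pointed (hence nonempty) types. *)
Definition borel_measurable (R : realType) (T : topologicalType) (f : T -> R)
    : Prop :=
  forall B : set (measurableTypeR R), measurable B ->
    (<<s @open T >>) (f @^-1` B).

Section MultiMarginal.
Context (R : realType) (d : nat) (X : 'I_d -> topologicalType).

Local Notation E := (prod_topology X).

(* The i-th point of the family is [x i]; one permutation is attached to each
   coordinate, the one attached to the first coordinate being the identity. *)
Definition c_cyclically_monotone (c : E -> R) (Gamma : set E) : Prop :=
  forall (n : nat) (x : 'I_n -> E) (sigma : 'I_d -> 'S_n),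
    (1 <= n)%N ->
    (forall i : 'I_n, Gamma (x i)) ->
    (forall j : 'I_d, j = 0%N :> nat -> sigma j = 1%g) ->
    \sum_(i < n) c (x i) <= \sum_(i < n) c (fun j : 'I_d => x (sigma j i) j).

(* No [phi j] takes the value +oo, so in the sums below a term -oo makes the
   whole sum equal to -oo. *)
Definition c_splitting (c : E -> R) (G : set E) : Prop :=
  exists phi : forall j : 'I_d, X j -> \bar R,
    [/\ forall (j : 'I_d) (t : X j), (phi j t < +oo)%E,
        forall x : E, (\sum_(j < d) phi j (x j) <= (c x)%:E)%E &
        forall x : E, G x -> (\sum_(j < d) phi j (x j))%E = (c x)%:E].

End MultiMarginal.

(* Main.v *)
Require Import Defs.
From mathcomp Require Import all_boot all_order all_algebra all_fingroup.
From mathcomp Require Import all_classical all_reals all_analysis.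

(** Splitting is dual to cyclical monotonicity: a family of functions [phi j]
satisfying linear constraints exists unless a nonnegative integer combination
of the constraints is contradictory, and such a contradiction is precisely a
violation of cyclical monotonicity.  Off the projections of [Gamma] the [phi j]
are set to -oo, so that only the points of the product of these projections
impose constraints.

The duality is obtained for an arbitrary, possibly infinite, set of
constraints at once.  In an abelian group [G], view a pair [(g, b)] as the
constraint f(g) <= b on an unknown additive f with real values.  Constraints
can be added, so they form a submonoid [S] of [G * R], and the only obstruction
to a solution is an element [(0, b)] with b < 0.  If there is none, Zorn's lemma
extends [S] to a maximal submonoid without obstruction, and maximality forces
the value of f at every g which [S] bounds from both sides; this is
[additive_minorant], a Hahn-Banach theorem over the integers.

Here [G] consists of integer-valued functions on the disjoint union of the
[X j], the point [x] of the product being encoded by the sum [marginals x] of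
the unit masses at its coordinates.  The constraints are generated by
f(marginals y - marginals x) <= c y - c x with x in [Gamma] and y arbitrary.
Because a sum of such constraints involves as many x as y, a constraint whose
left-hand side is f(0) compares two families of equal size with the same
marginals; these differ by one permutation in each coordinate, so cyclical
monotonicity says that the right-hand side is nonnegative
([exchange_monoid_consistent]).

If [Gamma] is empty, take every [phi j] to be -oo.  Otherwise fix x0 in [Gamma].
For a in the projection of [Gamma] to [X j], the difference of the unit masses
at a and at [x0 j] is bounded from both sides: it arises by changing the j-th coordinate of x0 into a, and its opposite by changing the
j-th coordinate of a point of [Gamma] above a into [x0 j].  Up to the constant
c(x0) / d, phi_j(a) is the value of f at this difference.  Summing over j gives
f(marginals x - marginals x0) + c(x0), which is at most c(x); when x is in
[Gamma] the roles of x and x0 can be exchanged, which gives equality. *)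

Set Implicit Arguments.
Unset Strict Implicit.
Unset Printing Implicit Defensive.

Local Open Scope classical_set_scope.

Import Order.TTheory GRing.Theory Num.Theory.
Local Open Scope ring_scope.

(** * Additive functions below a monoid of constraints *)

(** An element [(g, b)] of [S] is read as the constraint f(g) <= b on an
additive function f. *)
Definition consistent_monoid (R : realType) (G : zmodType) (S : set (G * R)) :=
  [/\ S (0, 0), forall u v, S u -> S v -> S (u + v)
    & forall b, S (0, b) -> 0 <= b].

Definition two_sided (R : realType) (G : zmodType) (S : set (G * R)) (g : G) :=
  (exists b, S (g, b)) /\ (exists b, S (- g, b)).

Lemma two_sided0 (R : realType) (G : zmodType) (S : set (G * R)) :
  consistent_monoid S -> two_sided S 0.
Proof. by move=> [S0 _ _]; split; exists 0; rewrite ?oppr0. Qed.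

Lemma two_sidedD (R : realType) (G : zmodType) (S : set (G * R)) g h :
  consistent_monoid S -> two_sided S g -> two_sided S h -> two_sided S (g + h).
Proof.
move=> [_ SD _] [[a Sa] [a' Sa']] [[b Sb] [b' Sb']]; split.
  by exists (a + b); exact: SD Sa Sb.
by exists (a' + b'); rewrite opprD; exact: SD Sa' Sb'.
Qed.

Lemma consistent_monoidMn (R : realType) (G : zmodType) (S : set (G * R)) u n :
  consistent_monoid S -> S u -> S (u *+ n).
Proof.
move=> [S0 SD _] Su; elim: n => [|n IH]; first by rewrite mulr0n.
by rewrite mulrS; exact: SD.
Qed.

Lemma pairMn (R : realType) (G : zmodType) (g : G) (b : R) n :
  (g, b) *+ n = (g *+ n, b *+ n).
Proof. by elim: n => [|n IH]; rewrite ?mulr0n // !mulrS IH. Qed.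

Lemma pairMz (R : realType) (G : zmodType) (g : G) (b : R) (k : int) :
  (g, b) *~ k = (g *~ k, b *~ k).
Proof. by case: k => n; rewrite -?NegzE /intmul /= pairMn. Qed.

(** The constraints on multiples of [g] confine a value t at [g] to an
interval: a constraint (n g, b) says t <= b / n, and a constraint (- m g, b')
says t >= - b' / m.  The interval is nonempty because m (n g, b) + n (- m g, b')
lies above 0, where consistency gives m b + n b' >= 0. *)
Lemma exists_value (R : realType) (G : zmodType) (S : set (G * R)) (g : G) :
  consistent_monoid S -> two_sided S g ->
  exists t : R, forall (k : int) b, S (g *~ k, b) -> t *~ k <= b.
Proof.
move=> mS [[b1 Sb1] [b0 Sb0]]; have [_ SD Spos] := mS.
(* The lower bounds imposed on t; t will be their supremum. *)
pose L := [set t | exists n b, S (- g *+ n.+1, b) /\ t = - b / n.+1%:R].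
have L_le n b : S (g *+ n.+1, b) -> ubound L (b / n.+1%:R).
  move=> Sb _ [m [b' [Sb' ->]]].
  rewrite ler_pdivrMr ?ltr0Sn// mulrAC ler_pdivlMr ?ltr0Sn//.
  rewrite mulNr -subr_ge0 opprK.
  apply: Spos; suff -> : ((0, b * m.+1%:R + b' * n.+1%:R) : G * R) =
      (g *+ n.+1, b) *+ m.+1 + (- g *+ m.+1, b') *+ n.+1.
    by apply: SD; exact: consistent_monoidMn.
  rewrite !pairMn -!mulrnA mulnC mulNrn !mulr_natr.
  by congr pair; rewrite subrr.
have L0 : L !=set0 by exists (- b0 / 1%:R), 0%N, b0; rewrite mulr1n.
exists (sup L) => -[[|n]|n] b.
- by rewrite !mulr0z => /Spos.
- rewrite -!pmulrn => /L_le bub.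
  by rewrite -mulr_natr -ler_pdivlMr ?ltr0Sn//; exact: ge_sup.
- rewrite !NegzE !mulrNz -!pmulrn -mulNrn => Sb.
  rewrite -mulr_natr lerNl -ler_pdivrMr ?ltr0Sn//.
  apply: ub_le_sup; last by exists n, b.
  by exists (b1 / 1%:R); apply: (L_le 0%N); rewrite mulr1n.
Qed.

(** Requiring f(g) = t amounts to adding both constraints (g, t) and
(- g, - t), that is, all integer multiples of (g, t); the hypothesis on t is
exactly what keeps the result consistent. *)
Lemma adjoin_value (R : realType) (G : zmodType) (S : set (G * R))
    (g : G) (t : R) :
  consistent_monoid S -> (forall (k : int) b, S (g *~ k, b) -> t *~ k <= b) ->
  consistent_monoid
    [set w | exists2 u, S u & exists k : int, w = u + (g, t) *~ k].
Proof.
move=> [S0 SD Spos] tP; split.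
- by exists (0, 0) => //; exists 0; rewrite mulr0z addr0.
- move=> _ _ [u Su [k ->]] [v Sv [l ->]]; exists (u + v); first exact: SD.
  by exists (k + l); rewrite mulrzDr addrACA.
- move=> b [[h b'] Sh [k]]; rewrite pairMz => -[/esym/eqP].
  rewrite addr_eq0 -mulrNz => /eqP hE ->.
  rewrite hE in Sh; have := tP _ _ Sh.
  by rewrite mulrNz lerNl -subr_ge0 opprK addrC.
Qed.

Lemma maximal_consistent_monoid (R : realType) (G : zmodType)
    (S : set (G * R)) :
  consistent_monoid S ->
  exists T, [/\ S `<=` T, consistent_monoid T
    & forall T', consistent_monoid T' -> T `<=` T' -> T' `<=` T].
Proof.
move=> mS.
(* The empty set is admitted since it is the union of the empty chain. *)
pose P T := T = set0 \/ (S `<=` T /\ consistent_monoid T).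
have [F FP Ftot|T [PT Tmax]] := @Zorn_bigcup _ P.
  have [[T FT T0]|F0] := pselect (exists2 T, F T & T != set0); last first.
    left; rewrite bigcup0 // => T FT; apply: contrapT => T0.
    by apply: F0; exists T => //; apply/eqP.
  have FG U x : F U -> U x -> S `<=` U /\ consistent_monoid U.
    by move=> FU Ux; case: (FP U FU) => // U0; rewrite U0 in Ux.
  have /set0P[x Tx] := T0; have [ST [T00 _ _]] := FG T x FT Tx.
  right; split; first by move=> y /ST Ty; exists T.
  split; first by exists T.
  - move=> u v [U FU Uu] [V FV Vv].
    have [UV|VU] := Ftot U V FU FV.
      exists V => //; have [_ [_ VD _]] := FG V v FV Vv.
      by apply: VD => //; exact: UV.
    exists U => //; have [_ [_ UD _]] := FG U u FU Uu.
    by apply: UD => //; exact: VU.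
  - by move=> b [U FU Ub]; have [_ [_ _]] := FG U _ FU Ub; apply.
have [ST mT] : S `<=` T /\ consistent_monoid T.
  case: PT => // T0; exfalso; apply: (Tmax S); last by right; split=> // u.
  rewrite T0; split=> //; have [S0 _ _] := mS.
  by move=> /(_ _ S0).
exists T; split=> // T' mT' TT'; apply: contrapT => nT'T.
by apply: (Tmax T') => //; right; split=> //; exact: subset_trans TT'.
Qed.

(** In a maximal monoid [T], a value t can be adjoined at each two-sided g, so
[T] already contains (g, t) and (- g, - t).  Consistency makes t unique, and
the monoid structure makes it additive in g.  Two-sidedness cannot be dropped:
an element bounded only from above may be bounded by every real number. *)
Lemma additive_minorant (R : realType) (G : zmodType) (S : set (G * R)) :
  consistent_monoid S ->
  exists f : G -> R,
    [/\ forall g b, two_sided S g -> S (g, b) -> f g <= b,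
        forall g, two_sided S g -> f (- g) = - f g
      & forall g h, two_sided S g -> two_sided S h -> f (g + h) = f g + f h].
Proof.
move=> /maximal_consistent_monoid[T [ST mT Tmax]].
have [T0 TD Tpos] := mT.
have decided g : two_sided S g -> exists t, T (g, t) /\ T (- g, - t).
  move=> [[b Sb] [b' Sb']].
  have [|t tP] := exists_value (g := g) mT.
    by split; [exists b|exists b']; exact: ST.
  exists t; split; apply: (Tmax _ (adjoin_value mT tP)) => /=.
  - by move=> u Tu; exists u => //; exists 0; rewrite mulr0z addr0.
  - by exists (0, 0) => //; exists 1; rewrite mulr1z add0r.
  - by move=> u Tu; exists u => //; exists 0; rewrite mulr0z addr0.
  - by exists (0, 0) => //; exists (-1); rewrite mulrN1z add0r.
have value_le g s b : T (- g, - s) -> T (g, b) -> s <= b.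
  move=> Ts Tb; rewrite -subr_ge0; apply: Tpos.
  by rewrite -(subrr g); exact: TD Tb Ts.
have value_unique g s t :
    T (g, s) /\ T (- g, - s) -> T (g, t) /\ T (- g, - t) -> s = t.
  move=> [Ts Ts'] [Tt Tt']; apply/eqP; rewrite eq_le.
  by rewrite (value_le _ _ _ Ts' Tt) (value_le _ _ _ Tt' Ts).
pose f g := xget 0 [set t | T (g, t) /\ T (- g, - t)].
have fE g t : T (g, t) /\ T (- g, - t) -> f g = t.
  move=> gt; apply: (value_unique g) (gt).
  exact: (@xgetI _ 0 [set t | T (g, t) /\ T (- g, - t)] t gt).
exists f; split.
- move=> g b /decided[t gt] Sb; rewrite (fE _ _ gt).
  by apply: (value_le g) (ST _ Sb); exact: gt.2.
- move=> g /decided[t gt]; rewrite (fE _ _ gt); apply: fE.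
  by rewrite !opprK; case: gt.
- move=> g h /decided[s [gs gs']] /decided[t [ht ht']].
  rewrite (fE g s)// (fE h t)//; apply: fE; split; first exact: TD gs ht.
  by rewrite !opprD; exact: TD gs' ht'.
Qed.

(** * Exchanging coordinates between points *)

Definition point_mass (d : nat) (X : 'I_d -> topologicalType) (j : 'I_d)
    (a : X j) : {j : 'I_d & X j} -> int := fun v => (v == Tagged X a)%:R.

Definition marginals (d : nat) (X : 'I_d -> topologicalType)
    (x : prod_topology X) : {j : 'I_d & X j} -> int :=
  \sum_(j < d) point_mass (x j).

Lemma marginalsE (d : nat) (X : 'I_d -> topologicalType) (x : prod_topology X)
  (j : 'I_d) (a : X j) : marginals x (Tagged X a) = (x j == a)%:R.
Proof.
rewrite /marginals fct_sumE /= (bigD1 j)//= big1 ?addr0 => [|k kj].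
  by rewrite /point_mass eq_Tagged /= eq_sym.
rewrite /point_mass; case: eqP => // /(congr1 tag)/= jk.
by rewrite jk eqxx in kj.
Qed.

(** Changing one coordinate moves one unit of mass. *)
Lemma marginals_dfwith (d : nat) (X : 'I_d -> topologicalType)
  (x : prod_topology X) (j : 'I_d) (a : X j) :
  marginals (dfwith x j a : prod_topology X) - marginals x =
  point_mass a - point_mass (x j).
Proof.
rewrite /marginals -sumrB (bigD1 j)//= dfwithin big1 ?addr0// => k kj.
by rewrite dfwithout 1?eq_sym// subrr.
Qed.

Lemma equal_marginals_perm (d n : nat) (X : 'I_d -> topologicalType)
  (y x : 'I_n -> prod_topology X) :
  \sum_(i < n) (marginals (y i) - marginals (x i)) = 0 ->
  forall j, exists s : 'S_n, forall i, y i j = x (s i) j.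
Proof.
move=> yx j.
have /tuple_permP[s sE] : perm_eq [tuple y i j | i < n] [tuple x i j | i < n].
  apply/allP => a _ /=.
  have countE (z : 'I_n -> prod_topology X) :
      (count_mem a [tuple z i j | i < n])%:R =
      \sum_(i < n) marginals (z i) (Tagged X a).
    rewrite -sum1_count big_mkcond big_tuple natr_sum; apply: eq_bigr => i _.
    by rewrite tnth_mktuple marginalsE /=; case: eqP.
  have := congr1 (fun g => g (Tagged X a)) yx.
  rewrite fct_sumE /= sumrB => /eqP.
  by rewrite subr_eq0 -!countE eqr_nat.
exists s => i.
have /(congr1 (fun t => tnth t i)) := val_inj sE.
by rewrite !tnth_mktuple.
Qed.

(** Equal marginals provide one permutation for each coordinate, after which
only the normalization of the first permutation is left. *)
Lemma cyclically_monotone_le (R : realType) (d n : nat)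
    (X : 'I_d -> topologicalType)
    (c : prod_topology X -> R) (Gamma : set (prod_topology X))
    (y x : 'I_n -> prod_topology X) :
  c_cyclically_monotone c Gamma -> (forall i, Gamma (x i)) ->
  \sum_(i < n) (marginals (y i) - marginals (x i)) = 0 ->
  \sum_(i < n) c (x i) <= \sum_(i < n) c (y i).
Proof.
case: n y x => [|n] y x cm Gx; first by rewrite !big_ord0.
move=> /equal_marginals_perm/choice[s sE].
(* Cyclical monotonicity requires the first permutation to be trivial, so the
   points y i are renumbered by the inverse of the first permutation t. *)
pose t : 'S_n.+1 := odflt 1%g (omap s [pick j : 'I_d | j == 0%N :> nat]).
have t0 (j : 'I_d) : j = 0%N :> nat -> s j = t.
  move=> j0; rewrite /t; case: pickP => [k /eqP k0|/(_ j)]; last by rewrite j0.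
  by rewrite /=; congr s; apply: val_inj; rewrite /= j0 k0.
have := cm n.+1 x (fun j => t^-1 * s j)%g isT Gx.
rewrite [X in _ -> _ <= X](reindex_perm t^-1%g) /=.
have yE i : y ((t^-1)%g i) = (fun j => x ((t^-1 * s j)%g i) j).
  by apply: functional_extensionality_dep => j; rewrite permM sE.
under [X in _ -> _ <= X]eq_bigr do rewrite yE.
by apply=> j /t0 ->; rewrite mulVg.
Qed.

(** The monoid generated by the constraints
f(marginals y - marginals x) <= c y - c x for x in [Gamma].  Constraints on
differences leave f free to shift each coordinate by a constant, so they remain
meaningful for the differences of unit masses in [exchange_two_sided], whereas
a single unit mass is not bounded by them. *)
Definition exchange_monoid (R : realType) (d : nat)
    (X : 'I_d -> topologicalType)
    (c : prod_topology X -> R) (Gamma : set (prod_topology X))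
    : set (({j : 'I_d & X j} -> int) * R) :=
  [set w | exists (n : nat) (y x : 'I_n -> prod_topology X),
     (forall i, Gamma (x i)) /\
     w = (\sum_(i < n) (marginals (y i) - marginals (x i)),
          \sum_(i < n) (c (y i) - c (x i)))].

Lemma exchange_monoid1 (R : realType) (d : nat) (X : 'I_d -> topologicalType)
    (c : prod_topology X -> R) (Gamma : set (prod_topology X)) y x :
  Gamma x -> exchange_monoid c Gamma (marginals y - marginals x, c y - c x).
Proof.
by move=> Gx; exists 1%N, (fun=> y), (fun=> x); rewrite !big_ord1.
Qed.

Lemma exchange_monoid_consistent (R : realType) (d : nat)
    (X : 'I_d -> topologicalType)
    (c : prod_topology X -> R) (Gamma : set (prod_topology X)) :
  c_cyclically_monotone c Gamma -> consistent_monoid (exchange_monoid c Gamma).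
Proof.
move=> cm; split.
- have z (x : 'I_0) : prod_topology X by case: x.
  by exists 0%N, z, z; rewrite !big_ord0; split=> // -[].
- move=> _ _ [n [y [x [Gx ->]]]] [m [y' [x' [Gx' ->]]]].
  pose join (u : 'I_n -> prod_topology X) (v : 'I_m -> prod_topology X)
      (k : 'I_(n + m)) : prod_topology X :=
    match fintype.split k with inl i => u i | inr i => v i end.
  have joinE (V : nmodType) (F : prod_topology X -> prod_topology X -> V) :
      \sum_(k < n + m) F (join y y' k) (join x x' k) =
      \sum_(i < n) F (y i) (x i) + \sum_(i < m) F (y' i) (x' i).
    rewrite big_split_ord /=; congr (_ + _); apply: eq_bigr => i _.
      by rewrite /join (unsplitK (inl i)).
    by rewrite /join (unsplitK (inr i)).
  exists (n + m)%N, (join y y'), (join x x'); split.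
    by move=> k; rewrite /join; case: fintype.split.
  rewrite (joinE _ (fun u v => marginals u - marginals v)).
  by rewrite (joinE _ (fun u v => c u - c v)).
- move=> b [n [y [x [Gx []]]]] /esym yx ->.
  by rewrite sumrB subr_ge0; exact: cyclically_monotone_le cm Gx yx.
Qed.

(** The upper bound comes from replacing the j-th coordinate of [x0] by that of
[y], the lower bound from the opposite replacement in [y]. *)
Lemma exchange_two_sided (R : realType) (d : nat) (X : 'I_d -> topologicalType)
    (c : prod_topology X -> R) (Gamma : set (prod_topology X))
    (x0 y : prod_topology X) (j : 'I_d) :
  Gamma x0 -> Gamma y ->
  two_sided (exchange_monoid c Gamma) (point_mass (y j) - point_mass (x0 j)).
Proof.
move=> Gx0 Gy; split; rewrite ?opprB -marginals_dfwith; eexists;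
  exact: exchange_monoid1.
Qed.

(** * The splitting functions *)

Theorem lemma2p5 (R : realType) (d : nat) (X : 'I_d -> topologicalType)
    (c : prod_topology X -> R) (Gamma : set (prod_topology X)) :
  (2 <= d)%N ->
  (forall j : 'I_d, polish_space R (X j)) ->
  borel_measurable c ->
  c_cyclically_monotone c Gamma ->
  c_splitting c Gamma.
Proof.
move=> d2 _ _ cm.
have [[x0 Gx0]|G0] := pselect (exists x0, Gamma x0); last first.
  exists (fun _ _ => -oo%E); split=> [//|x|x Gx]; last by case: G0; exists x.
  suff -> : (\sum_(j < d) -oo = -oo :> \bar R)%E by rewrite leNye.
  by apply/esum_eqNyP; exists (Ordinal (ltnW d2)); rewrite mem_index_enum.
have mS := exchange_monoid_consistent cm.
have [f [f_le fN fD]] := additive_minorant mS.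
pose shadow j (a : X j) := exists2 y, Gamma y & y j = a.
(* The constant c x0 / d makes the values at x0 add up to c x0. *)
pose g j (a : X j) := f (point_mass a - point_mass (x0 j)) + c x0 / d%:R.
have tw j a : shadow j a ->
    two_sided (exchange_monoid c Gamma) (point_mass a - point_mass (x0 j)).
  by move=> [y Gy <-]; exact: exchange_two_sided.
have gE (x : prod_topology X) : (forall j, shadow j (x j)) ->
  two_sided (exchange_monoid c Gamma) (marginals x - marginals x0) /\
  \sum_(j < d) g j (x j) = f (marginals x - marginals x0) + c x0.
  move=> sx; rewrite big_split /= sumr_const card_ord /marginals -sumrB.
  rewrite -[c x0 / _ *+ _]mulr_natr divfK ?pnatr_eq0 -?lt0n ?(ltnW d2)//.
  pose K u v := two_sided (exchange_monoid c Gamma) u /\ v = f u.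
  suff [? ->] : K (\sum_(j < d) (point_mass (x j) - point_mass (x0 j)))
    (\sum_(j < d) f (point_mass (x j) - point_mass (x0 j))) by [].
  apply: big_ind2 => [|u u' v v' [tu ->] [tv ->]|j _]; last first.
  - by split; [exact: tw|].
  - by split; [exact: two_sidedD|rewrite fD].
  - have t0 := two_sided0 mS; split=> //.
    by apply: (addrI (f 0)); rewrite -fD// !addr0.
(* Off the projections of Gamma no finite value is available in general, and
   the value -oo makes the inequality trivial. *)
exists (fun j a => if `[< shadow j a >] then (g j a)%:E else -oo%E).
have inside (x : prod_topology X) : (forall j, shadow j (x j)) ->
    (\sum_(j < d) (if `[< shadow j (x j) >] then (g j (x j))%:E else -oo) =
     (f (marginals x - marginals x0) + c x0)%:E)%E.
  move=> sx; rewrite -(gE x sx).2 -sumEFin; apply: eq_bigr => j _.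
  by rewrite asboolT.
split.
- by move=> j a; case: ifP; rewrite ?ltry.
- move=> x; have [sx|/existsNP[j nsj]] := pselect (forall j, shadow j (x j)).
    rewrite inside// lee_fin -lerBrDr; apply: f_le; first exact: (gE x sx).1.
    exact: exchange_monoid1.
  suff -> : (\sum_(j < d) (if `[< shadow j (x j) >] then (g j (x j))%:E
                           else -oo) = -oo :> \bar R)%E by rewrite leNye.
  by apply/esum_eqNyP; exists j; rewrite mem_index_enum asboolF.
- move=> x Gx; have sx j : shadow j (x j) by exists x.
  rewrite inside//; congr EFin; have [tx _] := gE x sx.
  apply/eqP; rewrite eq_le; apply/andP; split.
    by rewrite -lerBrDr; apply: f_le => //; exact: exchange_monoid1.
  have tx' : two_sided (exchange_monoid c Gamma) (marginals x0 - marginals x).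
    by rewrite -opprB; split; rewrite ?opprK; case: tx.
  (* The converse inequality exchanges the roles of x and x0. *)
  rewrite -lerBlDr -[f _]opprK -fN// lerNr !opprB.
  by apply: f_le => //; exact: exchange_monoid1.
Qed.
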